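(* For every $\Sigma\in T_n$, in the Poirier–Reutenauer Hopf algebra $\mathbb Z T$ one has $$\delta(\mathcal M_\Sigma)=\sum_{(U,V):\ \Sigma=V\bigtriangleup U}\mathcal M_U\otimes\mathcal M_V,$$ the sum running over all pairs of standard tableaux $U\in T_p$, $V\in T_q$ ($p+q=n$, including empty tableaux) with $V\bigtriangleup U=\Sigma$.
   Context: $T_m$ is the set of standard Young tableaux with entries $1,\ldots,m$ ($T_0$ contains only the empty tableau $\epsilon$), and $T=\bigcup_{m\geq0}T_m$. $P(\sigma)$ is the Robinson–Schensted insertion tableau of a permutation $\sigma$. Permutations are words; the right weak order on $S_m$ is inclusion of inversion sets (an inversion is a pair $(j,i)$, $j>i$, $j$ left of $i$). The Taskin weak order $\leq$ on $T_m$ is the transitive closure of: $U\leq V$ if there are $u\leq v$ in $S_m$ with $P(u)=U$, $P(v)=V$; it is a partial order. For $\sigma\in S_m$, $I\subseteq\{1,\ldots,m\}$, $\sigma\mid I$ is the word obtained by deleting letters not in $I$, $st$ is standardization (increasing relabelling onto $\{1,\ldots,k\}$), and for $\Sigma=P(\sigma)$, $st(\Sigma\mid I):=P(st(\sigma\mid I))$ (well defined). $\mathbb Z T$ is the free $\mathbb Z$-module with basis $T$ with the Hopf algebra structure (Poirier–Reutenauer) which is the quotient of the Malvenuto–Reutenauer Hopf algebra of permutations by plactic equivalence, $\sigma\mapsto P(\sigma)$; its coproduct is $\delta(\Sigma)=\sum_{p=0}^{n}st(\Sigma\mid\{1,\ldots,p\})\otimes st(\Sigma\mid\{p+1,\ldots,n\})$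 for $\Sigma\in T_n$. For $u\in S_p$, $v\in S_q$, $v\bigtriangleup u=\bar vu$ with $\bar v$ equal to $v$ with $p$ added to each letter; for tableaux, $V\bigtriangleup U:=P(v\bigtriangleup u)$ for any $u,v$ with $P(u)=U$, $P(v)=V$ (well defined). The monomial basis $(\mathcal M_W)_{W\in T}$ of $\mathbb Z T$ is defined by Möbius inversion on $(T_m,\leq)$ from the identities $\Sigma=\sum_{W\in T_m,\ \Sigma\leq W}\mathcal M_W$ for all $\Sigma\in T_m$. *)

(* Defs.v *)
From HB Require Import structures.
From mathcomp Require Import all_boot all_order all_algebra.
From mathcomp Require Import boolp.
From mathcomp.multinomials Require Import freeg.
From Stdlib Require Import Relation_Operators.

Set Implicit Arguments.
Unset Strict Implicit.
Unset Printing Implicit Defensive.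

Import GRing.Theory.

Local Open Scope nat_scope.

(* Tableaux are lists of rows in English notation, the longest row first;
   [above r s] says that the row [s] may be placed immediately below [r]. *)
Definition above (r s : seq nat) : bool :=
  (size s <= size r) && all (fun xy : nat * nat => xy.1 < xy.2) (zip r s).

Definition is_tab (t : seq (seq nat)) : bool :=
  [&& [::] \notin t, all (sorted ltn) t & sorted above t].

Definition is_stdtab (t : seq (seq nat)) : bool :=
  is_tab t && perm_eq (flatten t) (iota 1 (size (flatten t))).

Record stdtab := Stdtab { rows :> seq (seq nat); _ : is_stdtab rows }.

HB.instance Definition _ := [isSub for rows].
HB.instance Definition _ := [Countable of stdtab by <:].

Definition tsize (t : stdtab) : nat := size (flatten t).

Definition tab0 : stdtab := @Stdtab [::] isT.

Definition shapes (m : nat) : seq (seq nat) :=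
  flatten [seq [seq map val (tval s) | s : k.-tuple 'I_m.+1] | k <- iota 0 m.+1].

(* T_m as a duplicate-free list; see [mem_SYT]. *)
Definition SYT (m : nat) : seq stdtab :=
  [seq t <- undup (pmap insub
     [seq reshape sh w | sh <- shapes m, w <- permutations (iota 1 m)])
  | tsize t == m].

Lemma uniq_SYT m : uniq (SYT m).
Proof. by rewrite filter_uniq // undup_uniq. Qed.

Lemma mem_SYT m (t : stdtab) : (t \in SYT m) = (tsize t == m).
Proof.
rewrite mem_filter; case: eqP => //= tm.
rewrite mem_undup mem_pmap_sub; apply/allpairsP => /=.
exists (shape t, flatten t); rewrite /= flattenK; split=> //; last first.
  by rewrite mem_permutations -tm; case/andP: (valP t).
have ne : 0 \notin shape t.
  apply/negP => /mapP[r rt /esym/size0nil r0].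
  by case/andP: (valP t) => /and3P[/negP]; rewrite -r0.
have sm : sumn (shape t) = m by rewrite -size_flatten.
have sz s : 0 \notin s -> size s <= sumn s.
  elim: s => // x s IH; rewrite inE negb_or eq_sym -lt0n => /andP[x0 /IH] /=.
  by rewrite -add1n; apply: leq_add.
have le x s : x \in s -> x <= sumn s.
  elim: s => // y s IH; rewrite inE => /orP[/eqP->|/IH h] /=.
    exact: leq_addr.
  exact: leq_trans h (leq_addl _ _).
apply/flattenP; set k := size (shape t).
exists [seq map val (tval s) | s : k.-tuple 'I_m.+1].
  apply/mapP; exists k => //; rewrite mem_iota add0n ltnS -sm; exact: sz.
have szs : size (map (@inord m) (shape t)) == k by rewrite size_map.
apply/imageP; exists (Tuple szs) => //=.
rewrite -map_comp map_id_in // => x xs /=.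
by rewrite inordK // ltnS -sm; apply: le.
Qed.

Fixpoint ins_row (r : seq nat) (x : nat) : seq nat * option nat :=
  if r is y :: r' then
    if x < y then (x :: r', Some y)
    else let: (s, b) := ins_row r' x in (y :: s, b)
  else ([:: x], None).

Fixpoint ins (t : seq (seq nat)) (x : nat) : seq (seq nat) :=
  if t is r :: t' then
    let: (r', b) := ins_row r x in
    if b is Some y then r' :: ins t' y else r' :: t'
  else [:: [:: x]].

Definition rs (w : seq nat) : seq (seq nat) := foldl ins [::] w.

Lemma ins_row_perm r x :
  perm_eq ((ins_row r x).1 ++ seq_of_opt (ins_row r x).2) (x :: r).
Proof.
elim: r => //= y r IH; case: ifP => _ /=.
  by rewrite perm_cons cats1 perm_rcons.
case: (ins_row r x) IH => s b /= IH.
rewrite -(perm_cons y) in IH; apply: perm_trans IH _.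
by rewrite -[x :: y :: r]/([:: x] ++ [:: y] ++ r) perm_sym perm_catCA.
Qed.

Lemma ins_perm t x : perm_eq (flatten (ins t x)) (x :: flatten t).
Proof.
elim: t x => //= r t IH x; have := ins_row_perm r x.
case: (ins_row r x) => r' [y|] /= pr; last first.
  by rewrite -[x :: r ++ _]/((x :: r) ++ _) perm_cat2r -[r']cats0.
rewrite -[x :: r ++ _]/((x :: r) ++ _).
apply: (@perm_trans _ ((r' ++ [:: y]) ++ flatten t)); last by rewrite perm_cat2r.
by rewrite -catA perm_cat2l /=; apply: IH.
Qed.

Lemma rs_perm w : perm_eq (flatten (rs w)) w.
Proof.
rewrite /rs -[X in perm_eq _ X]/(flatten [::] ++ w).
elim: w [::] => [|x w IH] t /=; first by rewrite cats0.
apply: perm_trans (IH _) _; rewrite -cat1s catA perm_cat2r.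
by apply: perm_trans (ins_perm _ _) _; rewrite cats1 perm_sym perm_rcons.
Qed.

Lemma ins_row_path a r x : a < x -> path ltn a r -> x \notin r ->
  path ltn a (ins_row r x).1.
Proof.
elim: r a => [|y r IH] a /=; first by move=> ->.
move=> ax /andP[ay pr]; rewrite inE negb_or => /andP[xy xr].
case: ltnP => [lt|ge] /=.
  by rewrite ax /=; case: r pr {IH xr} => //= z r /andP[/(ltn_trans lt)-> ->].
have yx : y < x by rewrite ltn_neqAle eq_sym xy ge.
by have := IH y yx pr xr; case: (ins_row r x) => s b /= ->; rewrite ay.
Qed.

Lemma ins_row_sorted r x : sorted ltn r -> x \notin r ->
  sorted ltn (ins_row r x).1.
Proof.
case: r => //= y r pr; rewrite inE negb_or => /andP[xy xr].
case: ltnP => [lt|ge] /=.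
  by case: r pr {xr} => //= z r /andP[/(ltn_trans lt)-> ->].
have yx : y < x by rewrite ltn_neqAle eq_sym xy ge.
by have := ins_row_path yx pr xr; case: (ins_row r x).
Qed.

Lemma above_cons a r b s : above (a :: r) (b :: s) = (a < b) && above r s.
Proof. by rewrite /above /= ltnS andbCA. Qed.

Lemma above_nil r : above r [::].
Proof. by case: r. Qed.

Lemma ins_row_above r x s : above r s -> above (ins_row r x).1 s.
Proof.
elim: r s => [|y r IH] [|b s] //; rewrite ?above_nil //.
rewrite above_cons => /andP[yb rs_] /=.
case: ltnP => [lt|ge] /=; first by rewrite above_cons (ltn_trans lt yb).
by have := IH _ rs_; case: (ins_row r x) => s' c /=; rewrite above_cons yb.
Qed.

Lemma ins_row_bump r x r' y : ins_row r x = (r', Some y) -> y \in r.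
Proof.
elim: r r' => //= z r IH r'; case: ifP => _; first by case=> _ ->; rewrite mem_head.
by case E: (ins_row r x) => [s b] [_ eb]; rewrite inE (IH s) ?orbT // E eb.
Qed.

Lemma ins_row_above2 r x r' y s : sorted ltn r -> above r s ->
  ins_row r x = (r', Some y) -> above r' (ins_row s y).1.
Proof.
elim: r s r' => //= a r IH s r' par; case: ltnP => [lt|ge].
  case: s => [|b s] ab [<- <-] /=; first by rewrite above_cons lt above_nil.
  move: ab; rewrite above_cons => /andP[ab rs_].
  by rewrite ab /= above_cons lt.
case E: (ins_row r x) => [q c] ab [<- ec]; rewrite {}ec in E.
have ay : a < y by apply: (allP (order_path_min ltn_trans par)); exact: ins_row_bump E.
case: s ab => [_|b s]; first by rewrite /= above_cons ay above_nil.
rewrite above_cons => /andP[lab rs_] /=; case: ltnP => [lyb|gyb] /=.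
  by rewrite above_cons ay -[q]/((q, Some y).1) -E; apply: ins_row_above.
have := IH s q (path_sorted par) rs_ E.
by case: (ins_row s y) => s' d /=; rewrite above_cons lab.
Qed.

Lemma ins_row_neq0 r x : (ins_row r x).1 != [::].
Proof. by case: r => //= y r; case: ifP => // _; case: (ins_row r x). Qed.

Lemma ins_tab t x : is_tab t -> uniq (x :: flatten t) -> is_tab (ins t x).
Proof.
elim: t x => [|r t IH] x; first by [].
rewrite /is_tab /= inE negb_or => /and3P[/andP[r0 t0] /andP[sr st] prt].
rewrite mem_cat negb_or cat_uniq => /andP[/andP[xr xt] /and3P[ur disj ut]].
have sr' := ins_row_sorted sr xr.
have r0' := ins_row_neq0 r x.
have tabt : is_tab t by rewrite /is_tab t0 st (path_sorted prt).
case E: (ins_row r x) => [r' [y|]] /=; rewrite E /= in sr' r0'; last first.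
  rewrite inE negb_or eq_sym r0' t0 sr' st /=.
  case: t prt {IH t0 st xt disj ut tabt} => //= s t /andP[rs_ ->].
  by have := ins_row_above x rs_; rewrite E => ->.
have uy : uniq (y :: flatten t).
  rewrite /= ut andbT; apply: contra disj => yt.
  by apply/hasP; exists y => //; exact: ins_row_bump E.
have /and3P[i0 is_ ip] := IH y tabt uy.
rewrite inE negb_or eq_sym r0' i0 sr' is_ /=.
have: above r' (head [::] (ins t y)).
  case: t prt {IH t0 st xt disj ut tabt uy i0 is_ ip} => [_|s t /andP[rs_ _]] /=.
    by have := @ins_row_above2 r x r' y [::] sr (above_nil r) E.
  have := ins_row_above2 sr rs_ E.
  by case: (ins_row s y) => s' [].
by case: (ins t y) ip => //= s q ->; rewrite andbT.
Qed.

Lemma rs_tab w : uniq w -> is_tab (rs w).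
Proof.
elim/last_ind: w => // w x IH; rewrite rcons_uniq => /andP[xw uw].
rewrite /rs foldl_rcons; apply: ins_tab; first exact: IH.
by rewrite /= (perm_uniq (rs_perm w)) (perm_mem (rs_perm w)) xw.
Qed.

(* [w \in perms m] iff [perm_eq w (iota 1 m)], by [mem_permutations]. *)
Definition perms (m : nat) : seq (seq nat) := permutations (iota 1 m).

(* The insertion tableau of a permutation.  The default value [tab0] is only
   returned on words that are not permutations, see [val_P]. *)
Definition P (w : seq nat) : stdtab := insubd tab0 (rs w).

Lemma val_P w m : w \in perms m -> rows (P w) = rs w.
Proof.
rewrite mem_permutations => pw; rewrite /P -/(val _) insubdK //.
rewrite unfold_in /is_stdtab rs_tab ?(perm_uniq pw) ?iota_uniq //=.
rewrite (perm_size (rs_perm w)) (perm_size pw) size_iota.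
exact: perm_trans (rs_perm w) pw.
Qed.

Definition inversion (w : seq nat) (j i : nat) : bool :=
  [&& i \in w, j \in w, i < j & index j w < index i w].

(* Right weak order; [u] and [v] are meant to have the same letters. *)
Definition weak_le (u v : seq nat) : bool :=
  all (fun j => all (fun i => inversion u j i ==> inversion v j i) u) u.

Definition taskin_step (U V : stdtab) : Prop :=
  exists m u v, [/\ u \in perms m, v \in perms m, weak_le u v, P u = U & P v = V].

Definition taskin (U V : stdtab) : Prop := clos_trans stdtab taskin_step U V.

Definition std (w : seq nat) : seq nat :=
  [seq (index x (sort leq w)).+1 | x <- w].

(* A chosen permutation with insertion tableau [S]; by plactic invariance [restr]
   and [tri] below do not depend on the choice. *)
Definition repw (S : stdtab) : seq nat :=
  head [::] [seq w <- perms (tsize S) | P w == S].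

(* st(S | {a, ..., b}) *)
Definition restr (S : stdtab) (a b : nat) : stdtab :=
  P (std [seq x <- repw S | a <= x <= b]).

(* The tableau of the word v-bar u, where v-bar is v with |U| added to each letter. *)
Definition tri (V U : stdtab) : stdtab :=
  P (map (addn (tsize U)) (repw V) ++ repw U).

Local Open Scope ring_scope.

Notation ZT := {freeg stdtab / int}.

(* Z T ⊗ Z T is the free module on pairs of tableaux. *)
Notation ZTT := {freeg (stdtab * stdtab) / int}.

Definition tens (a b : ZT) : ZTT :=
  fglift (fun x => fglift (fun y => << (x, y) >> : ZTT) b) a.

Definition delta_tab (S : stdtab) : ZTT :=
  \sum_(p < (tsize S).+1)
     tens << restr S 1 p >> << restr S p.+1 (tsize S) >>.

Definition delta : ZT -> ZTT := fglift delta_tab.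

(* Möbius inversion of S = \sum_(W >= S) M_W, that is the recursion
   M_S = S - \sum_(W > S) M_W.  The counter [k] is a recursion depth: starting
   from #|T_m| it is at least the number of elements of any chain of T_m. *)
Fixpoint mono_rec (k : nat) (S : stdtab) : ZT :=
  if k is k'.+1 then
    << S >> - \sum_(W <- SYT (tsize S) | `[< taskin S W >] && (W != S))
                 mono_rec k' W
  else 0.

Definition mono (S : stdtab) : ZT := mono_rec (size (SYT (tsize S))) S.

(* Main.v *)
(* Greene's theorem gives, for each k and p, a description of the total length of
   the first k rows of the part of P(w) with entries < p as the largest number of
   letters of w | {1, ..., p - 1} covered by k disjoint increasing subwords.  These
   numbers determine P(w), are invariant under Knuth moves, and can only decrease
   when w acquires inversions.  Hence P(u) = P(v) iff u and v are plactic
   equivalent, so restriction and the product V △ U do not depend on the chosen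
   words, and the Taskin order is antisymmetric.

   For U of size p, restriction and △ are adjoint:
   S <= V △ U iff st(S | {1, ..., p}) <= U and st(S | {p + 1, ..., n}) <= V,
   because a word w lies below the word obtained by moving its letters > p in front
   of its letters <= p.  Expanding both tensor factors of delta(S) in the monomial
   basis then gives delta(S) as the sum over W >= S of the right-hand side for W,
   and Möbius inversion concludes. *)
Require Import Defs.
From mathcomp Require Import all_boot all_order all_algebra.
From mathcomp Require Import boolp zify.
From mathcomp.multinomials Require Import freeg.
From Stdlib Require Import Relation_Operators.

Set Implicit Arguments.
Unset Strict Implicit.
Unset Printing Implicit Defensive.

Import GRing.Theory.

Local Open Scope nat_scope.

(** * Inversions as two-letter subwords *)

Lemma mem2_filter (T : eqType) (q : pred T) w j i :
  mem2 (filter q w) j i = [&& q j, q i & mem2 w j i].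
Proof.
rewrite !mem2E; case: eqP => [->|_]; rewrite subseq_filter /=.
  by rewrite andbT andbA andbb.
by rewrite andbT andbA.
Qed.

Lemma mem2_uniq (T : eqType) (w : seq T) i j : uniq w -> i != j ->
  [&& i \in w, j \in w & index j w < index i w] = mem2 w j i.
Proof.
elim: w => [|a w IH] //= /andP[aw uw] ij.
rewrite mem2_cons !inE (eq_sym j) (eq_sym i).
case: (eqVneq a j) ij => [<-|aj] ij /=.
  by rewrite eq_sym in ij; rewrite (negbTE ij) andbT.
case: (eqVneq a i) => [ai|ai] /=; last by rewrite ltnS IH.
by rewrite ltn0 andbF; apply/esym/negbTE; apply: contra aw; rewrite ai => /mem2r.
Qed.

(** [mem2] is preferred to comparing indices because it computes on concatenations, filters and
    injective images. *)
Lemma inversion_mem2 w j i : uniq w -> inversion w j i = (i < j) && mem2 w j i.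
Proof.
move=> uw; rewrite /inversion; case: (ltnP i j) => ij; last by rewrite !andbF.
by rewrite -mem2_uniq ?neq_ltn ?ij //= andbA.
Qed.

Lemma weak_leP u v : uniq u -> uniq v ->
  reflect (forall i j, i < j -> mem2 u j i -> mem2 v j i) (weak_le u v).
Proof.
move=> uu uv; apply: (iffP allP) => [H i j ij m|H j ju].
  have /allP/(_ i (mem2r m)) := H j (mem2l m).
  by rewrite !inversion_mem2 // ij m.
apply/allP => i iu; rewrite !inversion_mem2 //; apply/implyP => /andP[ij m].
by rewrite ij H.
Qed.

Lemma weak_le_refl w : weak_le w w.
Proof. by apply/allP => j _; apply/allP => i _; apply: implybb. Qed.

(** * Plactic equivalence *)

(** Both moves are oriented so that the right-hand word has the additional inversion (z, x). *)
Inductive knuth : seq nat -> seq nat -> Prop :=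
| Knuth_xzy l r x y z of x < y & y < z :
    knuth (l ++ [:: x; z; y] ++ r) (l ++ [:: z; x; y] ++ r)
| Knuth_yxz l r x y z of x < y & y < z :
    knuth (l ++ [:: y; x; z] ++ r) (l ++ [:: y; z; x] ++ r).

Definition plactic := clos_refl_sym_trans (seq nat) knuth.

Lemma plactic_refl w : plactic w w. Proof. exact: rst_refl. Qed.

Lemma plactic_trans v u w : plactic u v -> plactic v w -> plactic u w.
Proof. exact: rst_trans. Qed.

Lemma plactic_sym u v : plactic u v -> plactic v u. Proof. exact: rst_sym. Qed.

Lemma knuth_perm u v : knuth u v -> perm_eq u v.
Proof.
case=> l r x y z _ _; rewrite perm_cat2l perm_cat2r.
  exact: permEl (perm_catCA [:: x] [:: z] [:: y]).
by rewrite perm_cons; exact: permEl (perm_catC [:: x] [:: z]).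
Qed.

Lemma plactic_perm u v : plactic u v -> perm_eq u v.
Proof.
elim=> {u v} [u v /knuth_perm|u|u v _ IH|u v w _ IH1 _ IH2] //.
  by rewrite perm_sym.
exact: perm_trans IH1 IH2.
Qed.

Lemma plactic_cat a b u v : plactic u v -> plactic (a ++ u ++ b) (a ++ v ++ b).
Proof.
elim=> {u v} [u v k|u|u v _ IH|u v w _ IH1 _ IH2]; last 3 first.
- exact: plactic_refl.
- exact: plactic_sym.
- exact: plactic_trans IH2.
by case: k => l r x y z xy yz; rewrite -!(catA l) -!(catA _ r b) !(catA a l);
   apply: rst_step; constructor.
Qed.

(** A Knuth move only exchanges x and z. If both survive the filter then so does y, by convexity of
    [q], and the move persists; if one of them is deleted, the two words become equal. *)
Lemma plactic_map_filter (f : nat -> nat) (q : pred nat) u v :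
  {in q &, {homo f : x y / x < y}} ->
  (forall x y z, x < y -> y < z -> q x -> q z -> q y) ->
  plactic u v -> plactic (map f (filter q u)) (map f (filter q v)).
Proof.
move=> fi qc; elim=> {u v} [u v k|u|u v _ IH|u v w _ IH1 _ IH2]; last 3 first.
- exact: plactic_refl.
- exact: plactic_sym.
- exact: plactic_trans IH2.
have sym (w1 w2 : seq nat) : w1 = w2 -> plactic w1 w2.
  by move=> ->; apply: plactic_refl.
case: k => l r x y z xy yz; rewrite !filter_cat !map_cat /=;
  case qx: (q x); case qz: (q z); try (by apply: sym; case: ifP).
- by rewrite (qc _ _ _ xy yz) //=; apply/rst_step/Knuth_xzy; apply: fi => //;
    apply: (qc _ _ _ xy yz).
- by rewrite (qc _ _ _ xy yz) //=; apply/rst_step/Knuth_yxz; apply: fi => //;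
    apply: (qc _ _ _ xy yz).
Qed.

(** The row reading word, from the bottom row up. *)
Definition reading (t : seq (seq nat)) : seq nat := flatten (rev t).

Lemma reading_cons r t : reading (r :: t) = reading t ++ r.
Proof. by rewrite /reading rev_cons -cats1 flatten_cat /= cats0. Qed.

(** [x] travels left through [r]: each letter that it crosses and the left neighbour of that letter
    are both larger than [x] and form a Knuth triple with it. *)
Lemma ins_row_plactic_lt a r x : sorted ltn (a :: r) -> x < a ->
  plactic (rcons (a :: r) x) [:: a, x & r].
Proof.
elim: r a => [|b r IH] a /=; first by move=> _ _; apply: plactic_refl.
move=> /andP[ab pr] xa.
apply: (@plactic_trans ([:: a] ++ [:: b, x & r] ++ [::])).
  rewrite -[a :: _]/([:: a] ++ (b :: rcons r x)) -[b :: rcons _ _]cats0.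
  by apply: plactic_cat; apply: IH => //; apply: ltn_trans ab.
by rewrite cats0; apply/rst_sym/rst_step/(@Knuth_yxz [::]).
Qed.

Lemma ins_row_plactic r x : sorted ltn r -> x \notin r ->
  plactic (rcons r x) (seq_of_opt (ins_row r x).2 ++ (ins_row r x).1).
Proof.
elim: r => [_ _|a r IH]; first exact: plactic_refl.
move=> sr; rewrite inE negb_or => /andP[xa xr].
have {}IH := IH (path_sorted sr) xr.
rewrite [ins_row _ _]/=; case: ltnP => [lt|ge]; first exact: ins_row_plactic_lt.
have {ge xa} ax : a < x by rewrite ltn_neqAle ge eq_sym xa.
(* The head of the new row lies strictly between [a] and the bumped letter [y], which lets [y] pass
   [a] by a Knuth move. *)
have hd : forall y, (ins_row r x).2 = Some y ->
    exists h s, [/\ (ins_row r x).1 = h :: s, a < h & h < y].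
  case: r sr xr {IH} => //= b r /andP[ab pr] _ y; case: ltnP => [lt [<-]|ge].
    by exists x, r.
  case E: (ins_row r x) => [s c] /= ec; exists b, s; split => //.
  apply: (allP (order_path_min ltn_trans pr)).
  by apply: (@ins_row_bump _ x s); rewrite E ec.
case: (ins_row r x) IH hd => s [y|] /= IH hd; last first.
  by rewrite -[a :: rcons _ _]cats0 -[a :: s]cats0;
    apply: (@plactic_cat [:: a] [::]).
have [h [s' [es ah hy]]] := hd y erefl; rewrite {}es in IH *.
apply: (@plactic_trans ([:: a] ++ (y :: h :: s') ++ [::])).
  by rewrite -[a :: _]cats0; apply: (@plactic_cat [:: a] [::]).
by rewrite cats0; apply/rst_step/(@Knuth_xzy [::]).
Qed.

Lemma ins_plactic t x : all (sorted ltn) t -> uniq (x :: flatten t) ->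
  plactic (rcons (reading t) x) (reading (ins t x)).
Proof.
elim: t x => [|r t IH] x /=; first by move=> _ _; apply: plactic_refl.
move=> /andP[sr st]; rewrite mem_cat negb_or cat_uniq.
move=> /andP[/andP[xr xt] /and3P[ur disj ut]].
have := ins_row_plactic sr xr.
case E: (ins_row r x) => [r' [y|]] /= pr; rewrite !reading_cons rcons_cat.
  have uy : uniq (y :: flatten t).
    rewrite /= ut andbT; apply: contra disj => yt.
    by apply/hasP; exists y => //; exact: ins_row_bump E.
  apply: (@plactic_trans (reading t ++ (y :: r'))).
    by have := plactic_cat (reading t) [::] pr; rewrite !cats0.
  by rewrite -cat_rcons; apply: (@plactic_cat [::]); apply: IH.
by have := plactic_cat (reading t) [::] pr; rewrite !cats0.
Qed.

Lemma rs_plactic w : uniq w -> plactic w (reading (rs w)).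
Proof.
elim/last_ind: w => [_|w x IH]; first exact: plactic_refl.
rewrite rcons_uniq => /andP[xw uw].
have -> : rs (rcons w x) = ins (rs w) x by rewrite /rs foldl_rcons.
apply: (@plactic_trans (rcons (reading (rs w)) x)).
  by rewrite -!cats1; apply: (@plactic_cat [::]); apply: IH.
apply: ins_plactic; first by case/and3P: (rs_tab uw).
by rewrite /= (perm_uniq (rs_perm w)) (perm_mem (rs_perm w)) xw.
Qed.

(** * Greene's theorem *)

(* Letters of colour at least [k] are uncoloured: [w] has [k] disjoint increasing
   subwords covering [n] letters. *)
Definition incr_coloring k (w : seq nat) (c : nat -> nat) :=
  forall i j, i < j -> mem2 w j i -> c i = c j -> k <= c i.

Definition incr_family k (w : seq nat) n :=
  exists2 c, incr_coloring k w c & n <= count (fun x => c x < k) w.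

(** A colouring is constrained only by inversions, so one that is valid for the word with more
    inversions stays valid. *)
Lemma incr_family_weak k u v n : perm_eq u v ->
  (forall i j, i < j -> mem2 u j i -> mem2 v j i) ->
  incr_family k v n -> incr_family k u n.
Proof.
move=> p H [c Hc nc]; exists c; last by rewrite (permP p).
by move=> i j ij m; apply: Hc => //; apply: H.
Qed.

Lemma mem2_cat3 (T : eqType) (l s r : seq T) j i :
  mem2 (l ++ s ++ r) j i =
  [|| mem2 l j i, mem2 s j i, mem2 r j i, (j \in l) && (i \in s),
      (j \in l) && (i \in r) | (j \in s) && (i \in r)].
Proof.
rewrite !mem2_cat mem_cat andb_orr.
by case: (mem2 l j i); case: (mem2 s j i); case: (mem2 r j i);
  case: (j \in l); case: (j \in s); case: (i \in s); case: (i \in r).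
Qed.

Lemma mem2_triple (T : eqType) (a b d j i : T) : i != j ->
  mem2 [:: a; b; d] j i =
  (j == a) && ((i == b) || (i == d)) || (j == b) && (i == d).
Proof.
move=> ij; rewrite !mem2_cons !inE (eq_sym a) (eq_sym b) (eq_sym d).
case: (eqVneq j a) => [<-|ja] /=.
  by rewrite (negbTE ij) /=; case: (i == b); case: (i == d); rewrite ?andbF.
case: (eqVneq j b) => [<-|jb] /=; first by rewrite (negbTE ij).
by case: eqP => // <-; rewrite (negbTE ij).
Qed.

(** The new colouring is [c] on [l], [f] on the middle factor and [g] after [c] on [r]. Renaming
    colours on [r] is how increasing subwords exchange tails. Inversions inside [l] or inside [r]
    are inherited; the last four hypotheses treat the others. *)
Lemma incr_family_recolor k l s t r c f g n :
  uniq (l ++ s ++ r) -> perm_eq s t ->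
  incr_coloring k (l ++ s ++ r) c ->
  n <= count (fun x => c x < k) (l ++ s ++ r) ->
  (forall a, (g a < k) = (a < k)) -> injective g ->
  count (fun x => f x < k) s = count (fun x => c x < k) s ->
  (forall i j, i < j -> mem2 t j i -> f i = f j -> k <= f i) ->
  (forall i j, i < j -> j \in l -> i \in s -> f i = c j -> k <= f i) ->
  (forall i j, i < j -> j \in l -> i \in r -> g (c i) = c j -> k <= c j) ->
  (forall i j, i < j -> j \in s -> i \in r -> g (c i) = f j -> k <= f j) ->
  incr_family k (l ++ t ++ r) n.
Proof.
move=> uu pst Hc nc gk gi fs Ht Hls Hlr Hsr.
move: uu; rewrite catA cat_uniq => /and3P[uls /hasPn dlsr ur].
move: uls; rewrite cat_uniq => /and3P[ul /hasPn dls us].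
pose d i := if i \in r then g (c i) else if i \in s then f i else c i.
have dr i : i \in r -> d i = g (c i) by rewrite /d => ->.
have ds i : i \in s -> d i = f i.
  move=> i_s; rewrite /d i_s; case: ifP => // /dlsr.
  by rewrite /= mem_cat i_s orbT.
have dl i : i \in l -> d i = c i.
  move=> il; rewrite /d; case: ifP => [/dlsr|_]; first by rewrite /= mem_cat il.
  by case: ifP => // /dls; rewrite /= il.
have mt := perm_mem pst.
exists d.
  move=> i j ij; rewrite mem2_cat3 -!mt => /or4P[m|m|m|/or3P[] /andP[jm im]].
  - rewrite !dl ?(mem2l m, mem2r m) //; apply: Hc => //.
    by rewrite mem2_cat3 m.
  - have := mem2l m; have := mem2r m; rewrite -!mt => im jm.
    by rewrite !ds //; apply: Ht.
  - rewrite !dr ?(mem2l m, mem2r m) // => /gi e.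
    rewrite leqNgt gk -leqNgt; apply: (Hc i j) => //.
    by rewrite mem2_cat3 m !orbT.
  - by rewrite (dl j) // ds //; apply: Hls.
  - by move=> e; rewrite e; move: e; rewrite (dl j) // dr //; apply: Hlr.
  - by move=> e; rewrite e; move: e; rewrite (ds j) // dr //; apply: Hsr.
apply: leq_trans nc _; rewrite !count_cat leq_add //.
  by apply: eq_leq; apply: eq_in_count => i il; rewrite dl.
rewrite leq_add //; apply: eq_leq.
  by rewrite -fs (permP pst); apply: eq_in_count => i; rewrite -mt => i_s; rewrite ds.
by apply: eq_in_count => i ir; rewrite dr.
Qed.

(* Greene's exchange argument.  If [x] and [z] carry the same colour then [y] does
   not, and the increasing subwords through [x] and [y] exchange their tails. *)
Lemma incr_family_switch k l r x y z s t n (u := l ++ s ++ r) (v := l ++ t ++ r) :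
  x < y -> y < z -> uniq u ->
  (s = [:: x; z; y] /\ t = [:: z; x; y]) \/ (s = [:: y; x; z] /\ t = [:: y; z; x]) ->
  incr_family k u n -> incr_family k v n.
Proof.
move=> xy yz uu st [c Hc nc].
have xz := ltn_trans xy yz.
have ms i : i \in s = [|| i == x, i == y | i == z].
  by case: st => -[-> _]; rewrite !inE;
    case: (i == x); case: (i == y); case: (i == z).
have mt i : i \in t = [|| i == x, i == y | i == z].
  by case: st => -[_ ->]; rewrite !inE;
    case: (i == x); case: (i == y); case: (i == z).
have pst : perm_eq s t.
  case: st => -[-> ->]; first exact: permEl (perm_catCA [:: x] [:: z] [:: y]).
  by rewrite perm_cons; exact: permEl (perm_catC [:: x] [:: z]).
have puv : perm_eq u v by rewrite perm_cat2l perm_cat2r.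
have Hll i j : i < j -> mem2 l j i -> c i = c j -> k <= c i.
  by move=> ij m; apply: Hc => //; rewrite mem2_cat3 m.
have Hrr i j : i < j -> mem2 r j i -> c i = c j -> k <= c i.
  by move=> ij m; apply: Hc => //; rewrite mem2_cat3 m !orbT.
have Hlr i j : i < j -> j \in l -> i \in r -> c i = c j -> k <= c i.
  by move=> ij m m'; apply: Hc => //; rewrite mem2_cat3 m m' !orbT.
have Hls i j : i < j -> j \in l -> i \in s -> c i = c j -> k <= c i.
  by move=> ij m m'; apply: Hc => //; rewrite mem2_cat3 m m' !orbT.
have Hsr i j : i < j -> j \in s -> i \in r -> c i = c j -> k <= c i.
  by move=> ij m m'; apply: Hc => //; rewrite mem2_cat3 m m' !orbT.
have sx : x \in s by rewrite ms eqxx.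
have sy : y \in s by rewrite ms eqxx orbT.
have sz : z \in s by rewrite ms eqxx !orbT.
have Ht i j : i < j -> mem2 t j i -> mem2 s j i \/ j = z /\ i = x.
  move=> ij; have ij' : i != j by rewrite neq_ltn ij.
  by case: st => -[-> ->]; rewrite !mem2_triple //; lia.
(* The only inversion of [t] absent from [s] is (z, x), so unless [x] and [z] share a colour below
   [k], the colouring [c] still works. *)
case: (boolP ((c x == c z) && (c x < k))) => [/andP[/eqP cxz cxk]|ncx]; last first.
  exists c; last by rewrite -(permP puv).
  move=> i j ij; rewrite mem2_cat3 => /or4P[m|m|m|/or3P[] /andP[m m']].
  - exact: Hll m.
  - case: (Ht _ _ ij m) => [m'|[-> ->]].
      by apply: Hc => //; rewrite mem2_cat3 m' !orbT.
    by move: ncx; lia.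
  - exact: Hrr m.
  - by apply: Hls => //; rewrite ms -mt.
  - exact: Hlr.
  - by apply: Hsr => //; rewrite ms -mt.
have cxy : c y <> c x.
  have: mem2 s z y \/ mem2 s y x.
    by case: st => -[-> _]; [left|right]; rewrite mem2_triple; lia.
  by move=> [] m e; [have := Hc y z yz | have := Hc x y xy];
    rewrite /u mem2_cat3 m /= !orbT; lia.
pose h a b e := fun i => if i == x then a else if i == y then b else e : nat.
have hx a b e : h a b e x = a by rewrite /h eqxx.
have hy a b e : h a b e y = b by rewrite /h eqxx gtn_eqF.
have hz a b e : h a b e z = e by rewrite /h !gtn_eqF.
have cnt f : count (fun i => f i < k) s = (f x < k) + (f y < k) + (f z < k).
  by case: st => -[-> _] /=; lia.
have Lx j : j \in l -> x < j -> c x = c j -> k <= c j.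
  by move=> jl xj e; rewrite -e; apply: Hls e.
have Ly j : j \in l -> y < j -> c y = c j -> k <= c j.
  by move=> jl xj e; rewrite -e; apply: Hls e.
have Lz j : j \in l -> z < j -> c z = c j -> k <= c j.
  by move=> jl xj e; rewrite -e; apply: Hls e.
have Rx i : i \in r -> i < x -> c i = c x -> k <= c i by move=> *; apply: Hsr sx _ _.
have Ry i : i \in r -> i < y -> c i = c y -> k <= c i by move=> *; apply: Hsr sy _ _.
have Rz i : i \in r -> i < z -> c i = c z -> k <= c i by move=> *; apply: Hsr sz _ _.
(* The transposition of the colours of [x] and [y]; on [r] it performs the exchange of tails. *)
pose sw a := if a == c x then c y else if a == c y then c x else a.
have swk : c y < k -> forall a, (sw a < k) = (a < k).
  by move=> yk a; rewrite /sw; clear -cxk yk; do !case: eqP; lia.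
have swi : injective sw by move=> a b; rewrite /sw; clear; do !case: eqP; lia.
have swlr : c y < k -> forall i j, i < j -> j \in l -> i \in r -> sw (c i) = c j -> k <= c j.
  move=> yk i j ij jl ir; rewrite /sw; case: eqP => [ex|_]; last case: eqP => [ey|_].
  - by move: (Ly _ jl) (Rz _ ir); clear -xy yz cxk cxz yk ij ex; lia.
  - by move: (Lx _ jl) (Ry _ ir); clear -xy yz cxk yk ij ey; lia.
  by move=> e; rewrite -e; apply: Hlr e.
case: st => -[es et].
- have tt i j : i < j -> mem2 t j i -> j = z /\ (i = x \/ i = y).
    by move=> ij; rewrite et mem2_triple; lia.
  (* In z x y the subword through [x] continues with [y] and the tail of [y], while [z], followed by
     its own tail, takes over the colour of [y]. *)
  pose f := h (c x) (c x) (c y).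
  have [fx fy fz] : [/\ f x = c x, f y = c x & f z = c y] by rewrite /f hx hy hz.
  have [ctt cls cs] : [/\ forall i j, i < j -> mem2 t j i -> f i = f j -> k <= f i,
    forall i j, i < j -> j \in l -> i \in s -> f i = c j -> k <= f i
    & count (fun i => f i < k) s = count (fun i => c i < k) s].
    split; last by rewrite !cnt fx fy fz -cxz; lia.
      by move=> i j ij /(tt _ _ ij)[-> []->]; rewrite ?fx ?fy ?fz; lia.
    move=> i j ij jl; move: (Lx _ jl) (Ly _ jl) (Lz _ jl); rewrite ms.
    by move=> Hx Hy Hz /or3P[] /eqP ei; rewrite ei in ij *; rewrite ?fx ?fy ?fz;
      clear -xy yz cxk cxz cxy Hx Hy Hz ij; lia.
  case: (ltnP (c y) k) => Bk.
    apply: (@incr_family_recolor k l s t r c f sw) => //; [exact: swk | exact: swlr |].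
    move=> i j ij; rewrite ms => js ir; move: js; move: (Rx _ ir) (Ry _ ir) (Rz _ ir).
    move=> Hx Hy Hz /or3P[] /eqP ej; rewrite ej in ij *; rewrite ?fx ?fy ?fz /sw;
      clear -xy yz cxk cxz cxy Hx Hy Hz ij Bk; do !case: eqP; lia.
  (* Here [y] is uncoloured: it replaces [z] in the subword through [x], and the tails stay in
     place. *)
  apply: (@incr_family_recolor k l s t r c f id) => //.
    by move=> i j ij jl ir e; rewrite -e; apply: Hlr e.
  move=> i j ij; rewrite ms => js ir; move: js; move: (Rx _ ir) (Ry _ ir) (Rz _ ir).
  by move=> Hx Hy Hz /or3P[] /eqP ej; rewrite ej in ij *; rewrite ?fx ?fy ?fz;
      clear -xy yz cxk cxz cxy Hx Hy Hz ij Bk; lia.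
- have tt i j : i < j -> mem2 t j i -> i = x /\ (j = z \/ j = y).
    by move=> ij; rewrite et mem2_triple; lia.
  case: (ltnP (c y) k) => Bk.
    (* In y z x the subword through [y] continues with [z] and the tail of [z], while [x] is
       followed by the former tail of [y]. *)
    pose f := h (c x) (c y) (c y).
    have [fx fy fz] : [/\ f x = c x, f y = c y & f z = c y] by rewrite /f hx hy hz.
    apply: (@incr_family_recolor k l s t r c f sw) => //; [exact: swk | | | | exact: swlr |].
    + by rewrite !cnt fx fy fz -cxz; lia.
    + by move=> i j ij /(tt _ _ ij)[-> []->]; rewrite ?fx ?fy ?fz; lia.
    + move=> i j ij jl; move: (Lx _ jl) (Ly _ jl) (Lz _ jl); rewrite ms.
      by move=> Hx Hy Hz /or3P[] /eqP ei; rewrite ei in ij *; rewrite ?fx ?fy ?fz;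
      clear -xy yz cxk cxz cxy Hx Hy Hz ij Bk; lia.
    + move=> i j ij; rewrite ms => js ir; move: js; move: (Rx _ ir) (Ry _ ir) (Rz _ ir).
      by move=> Hx Hy Hz /or3P[] /eqP ej; rewrite ej in ij *; rewrite ?fx ?fy ?fz /sw;
      clear -xy yz cxk cxz cxy Hx Hy Hz ij Bk; do !case: eqP; lia.
  (* Here [y] is uncoloured and replaces [x] before [z]. *)
  pose f := h (c y) (c x) (c x).
  have [fx fy fz] : [/\ f x = c y, f y = c x & f z = c x] by rewrite /f hx hy hz.
  apply: (@incr_family_recolor k l s t r c f id) => //.
  + by rewrite !cnt fx fy fz -cxz; lia.
  + by move=> i j ij /(tt _ _ ij)[-> []->]; rewrite ?fx ?fy ?fz; lia.
  + move=> i j ij jl; move: (Lx _ jl) (Ly _ jl) (Lz _ jl); rewrite ms.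
    by move=> Hx Hy Hz /or3P[] /eqP ei; rewrite ei in ij *; rewrite ?fx ?fy ?fz;
      clear -xy yz cxk cxz cxy Hx Hy Hz ij Bk; lia.
  + by move=> i j ij jl ir e; rewrite -e; apply: Hlr e.
  + move=> i j ij; rewrite ms => js ir; move: js; move: (Rx _ ir) (Ry _ ir) (Rz _ ir).
    by move=> Hx Hy Hz /or3P[] /eqP ej; rewrite ej in ij *; rewrite ?fx ?fy ?fz;
      clear -xy yz cxk cxz cxy Hx Hy Hz ij Bk; lia.
Qed.

Lemma incr_family_knuth k u v n : uniq u -> knuth u v ->
  incr_family k u n <-> incr_family k v n.
Proof.
move=> uu kuv; split.
  case: kuv uu => l r x y z xy yz uu; apply: (incr_family_switch xy yz) => //;
  by [left|right].
apply: incr_family_weak; first exact: knuth_perm.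
case: kuv {uu} => l r x y z xy yz i j ij; rewrite !mem2_cat3 !inE;
  rewrite !mem2_triple; lia.
Qed.

Lemma incr_family_plactic k u v n : uniq u -> plactic u v ->
  incr_family k u n <-> incr_family k v n.
Proof.
move=> + puv; elim: puv => {u v} [u v kuv|u|u v puv IH|u v w puv IH1 pvw IH2] uu //.
- exact: incr_family_knuth.
- by rewrite IH // (perm_uniq (plactic_perm puv)).
- by rewrite IH1 // IH2 // -(perm_uniq (plactic_perm puv)).
Qed.

(** * Increasing families in reading words *)

Lemma mem_reading t x : (x \in reading t) = (x \in flatten t).
Proof. by apply/flattenP/flattenP => -[r rt xr]; exists r; rewrite ?mem_rev // -mem_rev. Qed.

Lemma perm_reading t : perm_eq (reading t) (flatten t).
Proof.
elim: t => // r t IH; rewrite reading_cons /= perm_catC perm_cat2l //.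
Qed.

Lemma filter_reading (q : pred nat) t :
  filter q (reading t) = reading (map (filter q) t).
Proof. by rewrite /reading filter_flatten map_rev. Qed.

Lemma mem2_sorted_ltn r i j : sorted ltn r -> mem2 r j i -> j <= i.
Proof.
move=> sr; rewrite mem2E; case: eqP => [->//|_] /subseq_sorted - /(_ _ ltn_trans sr) /=.
by rewrite andbT => /ltnW.
Qed.

(** Colouring each letter by the index of its row makes the first [k] rows the required increasing
    subwords. *)
Lemma incr_family_reading_ge k t : all (sorted ltn) t -> uniq (flatten t) ->
  incr_family k (reading t) (size (flatten (take k t))).
Proof.
move=> st ut; pose c x := find (fun r : seq nat => x \in r) t.
exists c; last first.
  rewrite (permP (perm_reading t)) /c => {c}.
  elim: t k st ut => //= r t IH [|k] //= /andP[sr st].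
  rewrite cat_uniq => /and3P[ur /hasPn disj ut]; rewrite size_cat count_cat leq_add //.
    rewrite -(count_predT r); apply: eq_leq; apply: eq_in_count => x xr.
    by rewrite /= xr.
  apply: leq_trans (IH k st ut) _; apply: eq_leq; apply: eq_in_count => x xt /=.
  by rewrite (negbTE (disj _ xt)) ltnS.
move=> i j ij m ce; exfalso; have [jt it] := (mem2l m, mem2r m).
move: jt it ce m; rewrite !mem_reading /c => {c}.
elim: t st ut => //= r t IH /andP[sr st]; rewrite cat_uniq !mem_cat.
move=> /and3P[ur /hasPn disj ut]; rewrite reading_cons mem2_cat.
case ir: (i \in r); case jr: (j \in r) => //= jt it.
  rewrite mem2lf /=; last by rewrite mem_reading; apply/negP => /disj /=; rewrite jr.
  rewrite mem_reading andbT; move=> _ /orP[/(mem2_sorted_ltn sr)|/disj].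
    by rewrite leqNgt ij.
  by rewrite /= jr.
by move=> [] ce; rewrite (mem2lf (negbT jr)) andbF !orbF; apply: IH.
Qed.

Lemma above_trans : transitive above.
Proof.
move=> s r t; elim: r s t => [|a r IH] [|b s] [|d t] //; rewrite ?above_nil //.
rewrite !above_cons => /andP[ab rs_] /andP[bd st].
by rewrite (ltn_trans ab bd) (IH s).
Qed.

Lemma above_nth r s j : above r s -> j < size s -> nth 0 r j < nth 0 s j.
Proof.
elim: r s j => [|a r IH] [|b s] // j; rewrite above_cons => /andP[ab rs_].
by case: j => //= j; apply: IH.
Qed.

Lemma count_flatten_columns (T : Type) (x0 : T) N (q : pred T) (t : seq (seq T)) :
  (forall r, List.In r t -> size r <= N) ->
  count q (flatten t) =
    \sum_(b < N) count (fun r => (b < size r) && q (nth x0 r b)) t.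
Proof.
elim: t => [_|r t IH H] /=; first by rewrite big1.
rewrite count_cat big_split /= -IH => [|r' tr']; last by apply: H; right.
congr (_ + _); rewrite -(big_mkord xpredT (fun b => nat_of_bool ((b < size r) && q (nth x0 r b)))).
rewrite (big_cat_nat (n := size r)) //=; last by apply: H; left.
rewrite [X in _ = _ + X](_ : _ = 0) => [|]; last first.
  by rewrite big_nat big1 // => b /andP[rb _]; rewrite ltnNge rb.
by rewrite addn0 -sum1_count (big_nth x0) big_mkcond big_nat [RHS]big_nat;
  apply: eq_bigr => b /andP[_ ->] /=; case: (q _).
Qed.

(* A column is a decreasing subword of the reading word, so it meets each colour
   at most once. *)
Lemma uniq_column_colors k t c b : sorted above t -> incr_coloring k (reading t) c ->
  uniq [seq c (nth 0 r b) | r <- t & (b < size r) && (c (nth 0 r b) < k)].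
Proof.
elim: t => //= r t IH prt Hc.
have {}IH := IH (path_sorted prt) _; case: ifP => [/andP[br cr]|_] /=; last first.
  by apply: IH => i j ij m; apply: Hc; rewrite // reading_cons mem2_cat m.
rewrite IH ?andbT => [|i j ij m]; last first.
  by apply: Hc; rewrite // reading_cons mem2_cat m.
apply/mapP => -[s]; rewrite mem_filter => /andP[/andP[bs cs] st] ce.
suff: k <= c (nth 0 r b) by rewrite leqNgt cr.
apply: (Hc _ (nth 0 s b)) => //.
  by apply: above_nth => //; move/(order_path_min above_trans)/allP: prt; apply.
rewrite reading_cons mem2_cat; apply/orP; right.
by rewrite mem_nth // andbT mem_reading; apply/flattenP; exists s; rewrite ?mem_nth.
Qed.

(** A column of height h has at most min(k, h) coloured letters, and this is the number of its cells
    in the first [k] rows. *)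
Lemma incr_family_reading_le k t n : sorted above t ->
  incr_family k (reading t) n -> n <= size (flatten (take k t)).
Proof.
move=> at_ [c Hc nc]; apply: leq_trans nc _.
rewrite (permP (perm_reading t)) -count_predT.
have H r : List.In r t -> size r <= \max_(s <- t) size s.
  by move=> rt; apply: leq_bigmax_seq => //; elim: t rt {at_ Hc} => //= s t IH [->|/IH];
    rewrite inE ?eqxx // => ->; rewrite orbT.
rewrite !(count_flatten_columns 0 (N := \max_(s <- t) size s)) //; last first.
  move=> r rt; apply: H; rewrite -(cat_take_drop k t).
  by apply/List.in_or_app; left.
apply: leq_sum => -[b /= _] _.
rewrite [X in _ <= X](eq_count (a2 := fun r => b < size r)) => [|r]; last by rewrite andbT.
(* If column [b] meets every row of [take k t], its coloured letters have distinct colours below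
   [k]; otherwise the whole column lies in those rows and its height is the bound. *)
case: (boolP (all (fun r => b < size r) (take k t))).
  rewrite all_count => /eqP ->; rewrite size_take_min leq_min count_size andbT.
  rewrite -size_filter -(size_map (fun r => c (nth 0 r b))) -[X in _ <= X](size_iota 0).
  apply: uniq_leq_size; first exact: uniq_column_colors.
  by move=> a /mapP[r]; rewrite mem_filter mem_iota => /andP[/andP[_ ck] _] ->.
move=> nall; apply: (@leq_trans (count (fun r => b < size r) t)).
  by apply: sub_count => r /= /andP[].
elim: t k at_ nall {Hc H} => // r t IH [|k] //= prt; case: (ltnP b (size r)) => br /=.
  by move=> nall; rewrite leq_add2l IH // (path_sorted prt).
move=> _; rewrite (_ : count _ t = 0) //; apply/eqP; rewrite -leqn0 leqNgt -has_count.
apply/hasPn => s st; rewrite -leqNgt; apply: leq_trans br.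
by move/(order_path_min above_trans)/allP/(_ s st): prt => /andP[].
Qed.

(** Emptied rows are kept, so that row indices still agree with those of [t]. *)
Definition below p (t : seq (seq nat)) := map (filter (fun x => x < p)) t.

Lemma above_filter p r s : sorted ltn r -> sorted ltn s -> above r s ->
  above (filter (fun x => x < p) r) (filter (fun x => x < p) s).
Proof.
elim: r s => [|a r IH] [|b s] sr ss; rewrite ?above_nil //.
rewrite above_cons => /andP[ab rs_]; rewrite /=.
case: (ltnP b p) => [bp|pb]; last first.
  rewrite (_ : filter _ s = [::]) ?above_nil //; apply/eqP.
  rewrite -(negbK (_ == _)) -has_filter; apply/hasPn => x xs; rewrite -leqNgt.
  by rewrite (leq_trans pb) // ltnW // (allP (order_path_min ltn_trans ss)).
by rewrite (ltn_trans ab bp) above_cons ab IH ?(path_sorted sr) ?(path_sorted ss).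
Qed.

Lemma below_sorted p t : all (sorted ltn) t -> all (sorted ltn) (below p t).
Proof.
move=> /allP st; apply/allP => _ /mapP[r rt ->].
exact: sorted_filter ltn_trans _ _ (st r rt).
Qed.

Lemma below_above p t : all (sorted ltn) t -> sorted above t -> sorted above (below p t).
Proof.
elim: t => //= r [|s t] IH //= /andP[sr st] /andP[rs_ prt].
by rewrite above_filter //=; [apply: IH | case/andP: st].
Qed.

(** Deleting the letters at least [p] respects plactic equivalence and turns the reading word of [t]
    into that of [below p t], where the two bounds for reading words apply. *)
Lemma greene t w k p n : is_tab t -> uniq w -> plactic w (reading t) ->
  incr_family k (filter (fun x => x < p) w) n <-> n <= size (flatten (take k (below p t))).
Proof.
move=> /and3P[_ st at_] uw pl.
have uf : uniq (filter (fun x => x < p) w) by apply: filter_uniq.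
have ut : uniq (flatten (below p t)).
  rewrite /below -filter_flatten filter_uniq //.
  by rewrite -(perm_uniq (perm_reading t)) -(perm_uniq (plactic_perm pl)).
have pf : plactic (filter (fun x => x < p) w) (reading (below p t)).
  rewrite -filter_reading -[filter _ w]map_id -[filter _ (reading t)]map_id.
  apply: plactic_map_filter pl => // x y z xy yz _; exact: ltn_trans.
rewrite (incr_family_plactic _ _ uf pf); split.
  by apply: incr_family_reading_le; apply: below_above.
move=> nk; have [c Hc cn] := incr_family_reading_ge k (below_sorted p st) ut.
by exists c => //; apply: leq_trans cn.
Qed.

(** * Tableaux recovered from their Greene numbers *)

Lemma size_flatten_takeS (T : Type) k (t : seq (seq T)) :
  size (flatten (take k.+1 t)) = size (flatten (take k t)) + size (nth [::] t k).
Proof.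
elim: t k => [|r t IH] [|k] //=; first by rewrite take0 cats0.
by rewrite !size_cat IH addnA.
Qed.

(** Differences in [k] count the letters below [p] in one row, and differences in [p] then decide
    which letters that row contains; a strictly increasing row is determined by its letters. *)
Lemma tab_eq t1 t2 : is_tab t1 -> is_tab t2 ->
  (forall k p, size (flatten (take k (below p t1))) = size (flatten (take k (below p t2)))) ->
  t1 = t2.
Proof.
move=> /and3P[n1 s1 _] /and3P[n2 s2 _] H.
have srt t k : all (sorted ltn) t -> sorted ltn (nth [::] t k).
  move=> st; case: (ltnP k (size t)) => kt; last by rewrite nth_default.
  exact/(allP st)/mem_nth.
have cnt t k p : size (nth [::] (below p t) k) = count (fun x => x < p) (nth [::] t k).
  rewrite -size_filter; case: (ltnP k (size t)) => kt; first by rewrite (nth_map [::]).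
  by rewrite !nth_default ?size_map.
have nthE k : nth [::] t1 k = nth [::] t2 k.
  apply: (irr_sorted_eq ltn_trans ltnn); [exact: srt | exact: srt |].
  move=> x; rewrite -!has_pred1 !has_count.
  have cx p : count (fun x => x < p) (nth [::] t1 k) = count (fun x => x < p) (nth [::] t2 k).
    rewrite -!cnt; have := H k.+1 p; rewrite !size_flatten_takeS H; exact: addnI.
  have cS r : count (fun y => y < x.+1) r = count (fun y => y < x) r + count (pred1 x) r.
    elim: r => //= y r ->; rewrite ltnS leq_eqVlt; case: eqP => [->|]; rewrite ?ltnn /=; lia.
  by have := cx x.+1; rewrite !cS cx => /addnI ->.
(* Since [nth] returns the empty row past the end, equality of all rows bounds the lengths only
   because tableaux have no empty rows. *)
have szle (u v : seq (seq nat)) : [::] \notin u -> (forall k, nth [::] u k = nth [::] v k) ->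
    size u <= size v.
  move=> nu uv; rewrite leqNgt; apply/negP => lt; move: (mem_nth [::] lt).
  by rewrite uv nth_default // (negbTE nu).
apply: (@eq_from_nth _ [::]) => // .
by apply/eqP; rewrite eqn_leq !szle.
Qed.

(** Both tableaux record the Greene numbers of [w]. *)
Lemma rs_unique t w : is_tab t -> uniq w -> plactic w (reading t) -> rs w = t.
Proof.
move=> tt uw pl; apply: tab_eq => //; first exact: rs_tab.
move=> k p; apply/eqP; rewrite eqn_leq.
have g1 := greene k p _ (rs_tab uw) uw (rs_plactic uw).
have g2 := greene k p _ tt uw pl.
by apply/andP; split; [apply/g2/g1 | apply/g1/g2].
Qed.

Lemma rs_placticP u v : uniq u -> uniq v -> rs u = rs v <-> plactic u v.
Proof.
move=> uu uv; split=> [e|pl].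
  apply: plactic_trans (rs_plactic uu) _; rewrite e.
  exact/plactic_sym/rs_plactic.
apply: rs_unique => //; first exact: rs_tab.
exact: plactic_trans pl (rs_plactic uv).
Qed.

(** * Permutations and their insertion tableaux *)

Lemma perms_uniq n w : w \in perms n -> uniq w.
Proof. by rewrite mem_permutations => /perm_uniq ->; apply: iota_uniq. Qed.

Lemma mem_perms n w : w \in perms n -> w =i iota 1 n.
Proof. by rewrite mem_permutations => /perm_mem. Qed.

Lemma P_plactic n u v : u \in perms n -> v \in perms n -> P u = P v <-> plactic u v.
Proof.
move=> un vn; rewrite -rs_placticP ?(perms_uniq un) ?(perms_uniq vn) //.
by rewrite -(val_P un) -(val_P vn); split=> [->|/val_inj].
Qed.

Lemma tsize_P n w : w \in perms n -> Defs.tsize (P w) = n.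
Proof.
move=> wn; rewrite /Defs.tsize (val_P wn) (perm_size (rs_perm w)).
by move: wn; rewrite mem_permutations => /perm_size ->; rewrite size_iota.
Qed.

(** The reading word of [S] inserts to [S], so the list searched by [repw] is nonempty and its head
    is not the default. *)
Lemma repw_spec S : repw S \in perms (Defs.tsize S) /\ P (repw S) = S.
Proof.
have /andP[tS pS] := valP S.
have rS : reading S \in perms (Defs.tsize S).
  by rewrite mem_permutations; apply: perm_trans (perm_reading S) pS.
have PS : P (reading S) = S.
  apply: val_inj; rewrite /= (val_P rS); apply: rs_unique => //.
    exact: perms_uniq rS.
  exact: plactic_refl.
have: repw S \in [seq w <- perms (Defs.tsize S) | P w == S].
  have: reading S \in [seq w <- perms (Defs.tsize S) | P w == S].
    by rewrite mem_filter PS eqxx.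
  by rewrite /repw; case: filter => // w s _; rewrite mem_head.
by rewrite mem_filter => /andP[/eqP].
Qed.

Lemma repw_perms S : repw S \in perms (Defs.tsize S). Proof. by case: (repw_spec S). Qed.

Lemma repwK S : P (repw S) = S. Proof. by case: (repw_spec S). Qed.

(** * The Taskin order *)

Lemma taskin_step_tsize U V : taskin_step U V -> Defs.tsize U = Defs.tsize V.
Proof. by case=> m [u [v [um vm _ <- <-]]]; rewrite (tsize_P um) (tsize_P vm). Qed.

Lemma taskin_tsize U V : taskin U V -> Defs.tsize U = Defs.tsize V.
Proof. by elim=> [U' V' /taskin_step_tsize //|U' V' W _ -> _ ->]. Qed.

Lemma taskin_refl S : taskin S S.
Proof.
apply: t_step; exists (Defs.tsize S), (repw S), (repw S).
by split; rewrite ?repw_perms ?repwK ?weak_le_refl.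
Qed.

Lemma taskin_trans V U W : taskin U V -> taskin V W -> taskin U W.
Proof. exact: t_trans. Qed.

(** Gaining inversions, in particular among the letters below [p], can only destroy increasing
    families; Greene's theorem translates this into row lengths. *)
Lemma taskin_dominance U V k p : taskin U V ->
  size (flatten (take k (below p V))) <= size (flatten (take k (below p U))).
Proof.
elim=> {U V} [U V [m [u [v [um vm uv <- <-]]]]|U V W _ IH1 _ IH2]; last exact: leq_trans IH1.
have [uu uv'] := (perms_uniq um, perms_uniq vm).
rewrite (val_P um) (val_P vm).
have g1 := greene k p _ (rs_tab uu) uu (rs_plactic uu).
have g2 := greene k p _ (rs_tab uv') uv' (rs_plactic uv').
apply/g1; apply: incr_family_weak (iffRL (g2 _) (leqnn _)).
  apply: perm_filter; rewrite !mem_permutations in um vm.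
  by rewrite (perm_trans um) // perm_sym.
move=> i j ij; rewrite !mem2_filter => /and3P[-> -> m2] /=.
exact: (weak_leP uu uv' uv).
Qed.

Lemma taskin_anti U V : taskin U V -> taskin V U -> U = V.
Proof.
move=> UV VU; apply: val_inj; apply: tab_eq.
- by case/andP: (valP U).
- by case/andP: (valP V).
by move=> k p; apply/eqP; rewrite eqn_leq !taskin_dominance.
Qed.

(** * Restriction and the product △ *)

(** Standardized restriction of a permutation to an interval, written as a shift so that
    [plactic_map_filter] applies; see [std_seg]. *)
Definition seg a b (w : seq nat) : seq nat :=
  [seq x - a.-1 | x <- w & a <= x <= b].

Lemma seg_addn a b w : 0 < a ->
  map (addn a.-1) (seg a b w) = [seq x <- w | a <= x <= b].
Proof.
move=> a0; rewrite -map_comp map_id_in // => x; rewrite mem_filter => /andP[/andP[ax _] _] /=.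
by rewrite subnKC //; apply: leq_trans ax; apply: leq_pred.
Qed.

Lemma perm_filter_iota n a b w : w \in perms n -> 0 < a -> b <= n ->
  perm_eq [seq x <- w | a <= x <= b] (iota a (b.+1 - a)).
Proof.
move=> wn a0 bn; apply: uniq_perm; rewrite ?iota_uniq ?filter_uniq ?(perms_uniq wn) //.
by move=> x; rewrite mem_filter (mem_perms wn) !mem_iota; lia.
Qed.

Lemma seg_perms n a b w : w \in perms n -> 0 < a -> b <= n ->
  seg a b w \in perms (b.+1 - a).
Proof.
move=> wn a0 bn; rewrite mem_permutations; apply: (perm_map_inj (@addnI a.-1)).
by rewrite seg_addn // -iotaDl addn1 prednK //; apply: perm_filter_iota wn _ _.
Qed.

Lemma std_seg n a b w : w \in perms n -> 0 < a -> b <= n ->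
  std [seq x <- w | a <= x <= b] = seg a b w.
Proof.
move=> wn a0 bn; rewrite /std.
have -> : sort leq [seq x <- w | a <= x <= b] = iota a (b.+1 - a).
  apply: (sorted_eq leq_trans anti_leq); rewrite ?sort_sorted ?iota_sorted //.
    exact: leq_total.
  by rewrite perm_sort; apply: perm_filter_iota wn _ _.
apply/eq_in_map => x; rewrite mem_filter => /andP[/andP[ax xb] _].
rewrite -{1}(subnKC ax) -(nth_iota 0 a (n := b.+1 - a)); last by lia.
by rewrite index_uniq ?size_iota ?iota_uniq; lia.
Qed.

Lemma seg_plactic a b u v : plactic u v -> plactic (seg a b u) (seg a b v).
Proof. by apply: plactic_map_filter => [x y|x y z]; rewrite ?unfold_in /=; lia. Qed.

Lemma seg_weak_le n a b u v : u \in perms n -> v \in perms n -> 0 < a -> b <= n ->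
  weak_le u v -> weak_le (seg a b u) (seg a b v).
Proof.
move=> un vn a0 bn uv; have us := seg_perms un a0 bn; have vs := seg_perms vn a0 bn.
apply/(weak_leP (perms_uniq us) (perms_uniq vs)) => i j ij.
rewrite -(mem2_map (@addnI a.-1) _ _ (seg a b u)) -(mem2_map (@addnI a.-1) _ _ (seg a b v)).
rewrite !seg_addn // !mem2_filter => /and3P[-> -> /=].
by apply: (weak_leP (perms_uniq un) (perms_uniq vn) uv); rewrite ltn_add2l.
Qed.

(** The word chosen by [repw] is plactic equivalent to [w], and taking segments preserves this. *)
Lemma restr_P n a b w : w \in perms n -> 0 < a -> b <= n ->
  restr (P w) a b = P (seg a b w).
Proof.
move=> wn a0 bn; have := repw_perms (P w); rewrite (tsize_P wn) => rn.
rewrite /restr (std_seg rn) //; apply/(P_plactic (seg_perms rn a0 bn) (seg_perms wn a0 bn)).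
by apply: seg_plactic; apply/(P_plactic rn wn); rewrite repwK.
Qed.

Lemma tsize_restr S a b : 0 < a -> b <= Defs.tsize S ->
  Defs.tsize (restr S a b) = b.+1 - a.
Proof.
move=> a0 bS; rewrite -{1}(repwK S) (restr_P (repw_perms S)) //.
exact/tsize_P/(seg_perms (repw_perms S)).
Qed.

Lemma restr_taskin U V a b : 0 < a -> b <= Defs.tsize U -> taskin U V ->
  taskin (restr U a b) (restr V a b).
Proof.
move=> a0 bU UV; elim: UV bU => {U V} [U V [m [u [v [um vm uv <- <-]]]]|U V W UV IH1 VW IH2] bU.
  rewrite (tsize_P um) in bU; rewrite (restr_P um) // (restr_P vm) //.
  apply: t_step; exists (b.+1 - a), (seg a b u), (seg a b v).
  by split; rewrite ?(seg_perms um) ?(seg_perms vm) ?(seg_weak_le um vm).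
by apply: taskin_trans (IH1 bU) (IH2 _); rewrite -(taskin_tsize UV).
Qed.

(** The word v △ u, for u of size [p]. *)
Definition over p (v u : seq nat) : seq nat := map (addn p) v ++ u.

Lemma over_perms p q u v : u \in perms p -> v \in perms q -> over p v u \in perms (p + q).
Proof.
rewrite !mem_permutations => up vq; rewrite iotaD add1n.
rewrite /over (perm_trans (permEl (perm_catC _ _))) // perm_cat //.
by rewrite -[p.+1]addn1 iotaDl perm_map.
Qed.

Lemma over_plactic p u u' v v' : plactic u u' -> plactic v v' ->
  plactic (over p v u) (over p v' u').
Proof.
move=> uu vv; apply: (@plactic_trans (over p v' u)); rewrite /over.
  apply: (@plactic_cat [::]); rewrite -[v]filter_predT -[v']filter_predT.
  by apply: plactic_map_filter vv => // x y _ _; rewrite ltn_add2l.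
by have := plactic_cat (map (addn p) v') [::] uu; rewrite !cats0.
Qed.

Lemma over_weak_le p q u u' v v' : u \in perms p -> u' \in perms p ->
  v \in perms q -> v' \in perms q -> weak_le u u' -> weak_le v v' ->
  weak_le (over p v u) (over p v' u').
Proof.
move=> up up' vq vq' uu vv.
have [o o'] := (over_perms up vq, over_perms up' vq').
apply/(weak_leP (perms_uniq o) (perms_uniq o')) => i j ij.
rewrite !mem2_cat => /orP[/orP[m|m]|/andP[jv iu]].
- have [/mapP[j' _ ej] /mapP[i' _ ei]] := (mem2l m, mem2r m).
  rewrite ei ej in ij m *; move: m; rewrite !(mem2_map (@addnI p)).
  rewrite ltn_add2l in ij.
  by move/(weak_leP (perms_uniq vq) (perms_uniq vq') vv _ _ ij) => ->.
- by rewrite (weak_leP (perms_uniq up) (perms_uniq up') uu _ _ ij m) orbT.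
have -> : i \in u' by rewrite (mem_perms up') -(mem_perms up).
suff -> : j \in map (addn p) v' by rewrite orbT.
case/mapP: jv => j' jv ->; rewrite map_f // (mem_perms vq') -(mem_perms vq) //.
Qed.

Lemma tri_P p q u v : u \in perms p -> v \in perms q -> tri (P v) (P u) = P (over p v u).
Proof.
move=> up vq; rewrite /tri (tsize_P up).
have [ru rv] := (repw_perms (P u), repw_perms (P v)).
rewrite (tsize_P up) in ru; rewrite (tsize_P vq) in rv.
apply/(P_plactic (over_perms ru rv) (over_perms up vq)); apply: over_plactic.
  by apply/(P_plactic ru up); rewrite repwK.
by apply/(P_plactic rv vq); rewrite repwK.
Qed.

Lemma tsize_tri V U : Defs.tsize (tri V U) = Defs.tsize U + Defs.tsize V.
Proof. exact/tsize_P/over_perms/repw_perms/repw_perms. Qed.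

(** By transitivity one factor moves at a time, along single steps, while the other is represented
    by a fixed word. *)
Lemma tri_taskin U U' V V' : taskin U U' -> taskin V V' -> taskin (tri V U) (tri V' U').
Proof.
move=> UU VV; apply: (@taskin_trans (tri V U')).
  elim: UU => {U U'} [U U' [m [u [v [um vm uv <- <-]]]]|U W U' _ IH1 _ IH2]; last first.
    exact: taskin_trans IH2.
  have rV := repw_perms V; rewrite -{1 2}(repwK V) (tri_P um rV) (tri_P vm rV).
  apply: t_step; exists (m + Defs.tsize V), (over m (repw V) u), (over m (repw V) v).
  by split; rewrite ?(over_perms um) ?(over_perms vm) ?(over_weak_le um vm rV) ?weak_le_refl.
elim: VV => {V V'} [V V' [m [u [v [um vm uv <- <-]]]]|V W V' _ IH1 _ IH2]; last first.
  exact: taskin_trans IH2.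
have rU := repw_perms U'; rewrite -{1 2}(repwK U') (tri_P rU um) (tri_P rU vm).
set p := Defs.tsize U'.
apply: t_step; exists (p + m), (over p u (repw U')), (over p v (repw U')).
by split; rewrite ?(over_perms rU) ?(over_weak_le rU rU um vm) ?weak_le_refl.
Qed.

Lemma restr_tri_lo V U : restr (tri V U) 1 (Defs.tsize U) = U.
Proof.
have o := over_perms (repw_perms U) (repw_perms V).
rewrite [tri V U]/(P (over _ _ _)) (restr_P o) ?leq_addr // -[RHS]repwK; congr P.
rewrite /seg /over /=.
rewrite (eq_map (g := id)) => [|x]; last exact: subn0.
rewrite map_id filter_cat filter_map (eq_in_filter (a2 := pred0)) => [|x /=]; last first.
  by rewrite (mem_perms (repw_perms V)) mem_iota; lia.
rewrite filter_pred0 /= -[RHS]filter_predT; apply: eq_in_filter => x /=.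
by rewrite (mem_perms (repw_perms U)) mem_iota; lia.
Qed.

Lemma restr_tri_hi V U :
  restr (tri V U) (Defs.tsize U).+1 (Defs.tsize U + Defs.tsize V) = V.
Proof.
have o := over_perms (repw_perms U) (repw_perms V).
rewrite [tri V U]/(P (over _ _ _)) (restr_P o) // -[RHS]repwK; congr P.
rewrite /seg /over /= filter_cat filter_map.
rewrite [X in _ ++ X](eq_in_filter (a2 := pred0)) => [|x /=]; last first.
  by rewrite (mem_perms (repw_perms U)) mem_iota; lia.
rewrite filter_pred0 cats0 (eq_in_filter (a2 := predT)) => [|x /=]; last first.
  by rewrite (mem_perms (repw_perms V)) mem_iota; lia.
by rewrite filter_predT -map_comp map_id_in // => x _ /=; rewrite addKn.
Qed.

(** Moving the letters above [p] to the front loses no inversion (j, i): letters on the same side of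
    [p] keep their order, and otherwise i <= p < j, so j ends up before i. *)
Lemma taskin_tri_restr S p : p <= Defs.tsize S ->
  taskin S (tri (restr S p.+1 (Defs.tsize S)) (restr S 1 p)).
Proof.
set n := Defs.tsize S => pn; set w := repw S.
have wn : w \in perms n := repw_perms S.
have [lo hi] := (seg_perms wn (ltn0Sn 0) pn, seg_perms wn (ltn0Sn p) (leqnn n)).
rewrite subSS subn0 in lo; rewrite subSS in hi.
suff: taskin (P w) (tri (restr (P w) p.+1 n) (restr (P w) 1 p)) by rewrite repwK.
rewrite !(restr_P wn) // (tri_P lo hi).
have o := over_perms lo hi; rewrite subnKC // in o.
apply: t_step; exists n, w, (over p (seg p.+1 n w) (seg 1 p w)); split=> //.
apply/(weak_leP (perms_uniq wn) (perms_uniq o)) => i j ij m.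
have := seg_addn p w (ltn0Sn 0); rewrite (eq_map add0n) map_id => e1.
rewrite /over (seg_addn n w (ltn0Sn p)) e1.
rewrite mem2_cat !mem2_filter !mem_filter m (mem2l m) (mem2r m).
by move: (mem2l m) (mem2r m); rewrite !(mem_perms wn) !mem_iota; lia.
Qed.

(** Restricting [tri V U] gives back [U] and [V], so one direction is monotonicity of restriction;
    the other combines [taskin_tri_restr] with monotonicity of [tri]. *)
Lemma taskin_triP S U V : Defs.tsize S = Defs.tsize U + Defs.tsize V ->
  taskin S (tri V U) <->
  taskin (restr S 1 (Defs.tsize U)) U /\
  taskin (restr S (Defs.tsize U).+1 (Defs.tsize S)) V.
Proof.
move=> sS; split=> [le|[lo hi]].
  split.
    by rewrite -[X in taskin _ X](restr_tri_lo V); apply: restr_taskin => //; rewrite sS leq_addr.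
  by rewrite -[X in taskin _ X](restr_tri_hi V U) -sS; apply: restr_taskin.
apply: taskin_trans (taskin_tri_restr _) (tri_taskin lo hi).
by rewrite sS leq_addr.
Qed.

(** * The monomial basis *)

Local Open Scope ring_scope.

Lemma fgliftB (R : nzRingType) (K : choiceType) (M : lmodType R) (f : K -> M)
    (x y : {freeg K / R}) :
  fglift f (x - y) = fglift f x - fglift f y.
Proof. exact: lift_is_additive. Qed.

Lemma fglift0 (R : nzRingType) (K : choiceType) (M : lmodType R) (f : K -> M) : fglift f 0 = 0.
Proof. by rewrite -[0]subr0 fgliftB subrr. Qed.

Lemma fgliftD (R : nzRingType) (K : choiceType) (M : lmodType R) (f : K -> M)
    (x y : {freeg K / R}) :
  fglift f (x + y) = fglift f x + fglift f y.
Proof. by rewrite -{1}[y]opprK fgliftB -[- y]sub0r fgliftB fglift0 sub0r opprK. Qed.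

Lemma fglift_sum (R : nzRingType) (K : choiceType) (M : lmodType R) (f : K -> M)
    (I : Type) (r : seq I) (Q : pred I) (F : I -> {freeg K / R}) :
  fglift f (\sum_(i <- r | Q i) F i) = \sum_(i <- r | Q i) fglift f (F i).
Proof. exact: (big_morph _ (fgliftD f) (fglift0 f)). Qed.

Lemma fgliftU1 (R : nzRingType) (K : choiceType) (M : lmodType R) (f : K -> M) (k : K) :
  fglift f << k >> = f k.
Proof. by rewrite liftU scale1r. Qed.

Definition upper (S W : stdtab) : bool := `[< taskin S W >].

(** The up-set of [W] lies in that of [S] by transitivity and misses [S] by antisymmetry. This is
    the measure for both inductions below. *)
Lemma upper_count_lt S W : upper S W -> W != S ->
  (count (upper W) (SYT (Defs.tsize W)) < count (upper S) (SYT (Defs.tsize S)))%N.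
Proof.
move=> /asboolP SW WS; rewrite -(taskin_tsize SW).
have uS : upper S S by apply/asboolP/taskin_refl.
have wS : ~~ upper W S.
  by apply/negP => /asboolP WS'; move/eqP: WS; apply; apply: taskin_anti.
have mS : S \in SYT (Defs.tsize S) by rewrite mem_SYT.
elim: (SYT _) mS => //= T r IH.
have sub : (upper W T <= upper S T)%N.
  case: (boolP (upper W T)) => // /asboolP WT.
  by rewrite (_ : upper S T) //; apply/asboolP/(taskin_trans SW).
have subr : (count (upper W) r <= count (upper S) r)%N.
  by apply: sub_count => T' /asboolP WT'; apply/asboolP/(taskin_trans SW).
rewrite inE => /orP[/eqP eT|/IH lt]; last by rewrite -addnS leq_add.
by rewrite -eT uS (negbTE wS) add0n add1n ltnS.
Qed.

(* The recursion depth chosen in [mono] is large enough. *)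
Lemma mono_rec_stable k k' S :
  (count (upper S) (SYT (Defs.tsize S)) <= k)%N ->
  (count (upper S) (SYT (Defs.tsize S)) <= k')%N -> mono_rec k S = mono_rec k' S.
Proof.
have pos : (0 < count (upper S) (SYT (Defs.tsize S)))%N.
  rewrite -has_count; apply/hasP; exists S; first by rewrite mem_SYT.
  exact/asboolP/taskin_refl.
elim: k k' S pos => [|k IH] k' S pos Sk Sk'; first by move: (leq_trans pos Sk).
case: k' Sk' => [|k'] Sk'; first by move: (leq_trans pos Sk').
rewrite /=; congr (_ - _); rewrite big_seq_cond [RHS]big_seq_cond.
apply: eq_bigr => W /andP[WS /andP[SW neWS]].
have lt := upper_count_lt SW neWS.
apply: IH; first 1 last.
- by rewrite -ltnS; apply: leq_trans lt Sk.
- by rewrite -ltnS; apply: leq_trans lt Sk'.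
rewrite -has_count; apply/hasP; exists W; first by rewrite mem_SYT.
exact/asboolP/taskin_refl.
Qed.

Lemma big_upperD1 (M : zmodType) (F : stdtab -> M) S :
  \sum_(W <- SYT (Defs.tsize S) | upper S W) F W =
  F S + \sum_(W <- SYT (Defs.tsize S) | upper S W && (W != S)) F W.
Proof.
rewrite big_mkcond (bigD1_seq S) ?uniq_SYT ?mem_SYT //=.
rewrite (_ : upper S S); last exact/asboolP/taskin_refl.
by rewrite -big_mkcondr; congr (_ + _); apply: eq_bigl => W; rewrite andbC.
Qed.

Lemma sum_mono S :
  << S >> = \sum_(W <- SYT (Defs.tsize S) | upper S W) mono W :> ZT.
Proof.
rewrite big_upperD1 {1}/mono.
(* With one more level of depth, [mono_rec] unfolds to the Möbius recursion whose inner depth is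
   again that of [mono]. *)
rewrite (mono_rec_stable (k' := (size (SYT (Defs.tsize S))).+1)) ?count_size //=;
  last by rewrite (leq_trans (count_size _ _)).
rewrite -[LHS]addr0 -addrA; congr (_ + _); apply/esym/eqP.
rewrite addrC subr_eq0; apply/eqP; rewrite big_seq_cond [RHS]big_seq_cond.
apply: eq_bigr => W /andP[]; rewrite mem_SYT /mono => /eqP -> /andP[SW WS].
by [].
Qed.

(** * The coproduct in the monomial basis *)

Lemma tens_sum (I : Type) (r : seq I) (Q : pred I) (A : I -> ZT) (b : ZT) :
  tens (\sum_(i <- r | Q i) A i) b = \sum_(i <- r | Q i) tens (A i) b.
Proof. exact: fglift_sum. Qed.

Lemma tensU_sum (I : Type) (r : seq I) (Q : pred I) (x : stdtab) (B : I -> ZT) :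
  tens << x >> (\sum_(i <- r | Q i) B i) = \sum_(i <- r | Q i) tens << x >> (B i).
Proof. by rewrite /tens fgliftU1 fglift_sum; apply: eq_bigr => i _; rewrite fgliftU1. Qed.

Definition mono_delta (S : stdtab) : ZTT :=
  \sum_(p < (Defs.tsize S).+1) \sum_(U <- SYT p)
    \sum_(V <- SYT (Defs.tsize S - p)%N | tri V U == S) tens (mono U) (mono V).

(** Once both factors are expanded, [taskin_triP] merges the conditions on [U] and [V] into one on
    [tri V U], and the pairs are grouped by the value W of [tri V U]. *)
Lemma delta_tab_mono S :
  delta_tab S = \sum_(W <- SYT (Defs.tsize S) | upper S W) mono_delta W.
Proof.
transitivity (\sum_(W <- SYT (Defs.tsize S) | upper S W)
    \sum_(p < (Defs.tsize S).+1) \sum_(U <- SYT p)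
    \sum_(V <- SYT (Defs.tsize S - p)%N | tri V U == W) tens (mono U) (mono V)); last first.
  rewrite big_seq_cond [RHS]big_seq_cond; apply: eq_bigr => W /andP[].
  by rewrite mem_SYT /mono_delta => /eqP ->.
rewrite exchange_big; apply: eq_bigr => -[p /= pS] _; rewrite ltnS in pS.
transitivity (\sum_(U <- SYT p | upper (restr S 1 p) U)
   \sum_(V <- SYT (Defs.tsize S - p)%N | upper (restr S p.+1 (Defs.tsize S)) V)
      tens (mono U) (mono V)).
  rewrite (sum_mono (restr S p.+1 _)) tensU_sum tsize_restr // subSS exchange_big.
  by apply: eq_bigr => V _; rewrite (sum_mono (restr S 1 p)) tens_sum tsize_restr // subSS subn0.
rewrite [RHS]exchange_big /= big_mkcond big_seq [RHS]big_seq.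
apply: eq_bigr => U; rewrite mem_SYT => /eqP Up.
transitivity (\sum_(V <- SYT (Defs.tsize S - p)%N | upper S (tri V U)) tens (mono U) (mono V)).
  (* Membership of [V] in the range is kept in the predicate because the adjunction requires the
     sizes to add up. *)
  rewrite [RHS]big_seq_cond (eq_bigl (fun V => (V \in SYT (Defs.tsize S - p)%N) &&
     (upper (restr S 1 p) U && upper (restr S p.+1 (Defs.tsize S)) V))) => [|V].
    by rewrite -big_seq_cond; case: (upper _ U); rewrite //= big_pred0_eq.
  rewrite mem_SYT; case: eqP => //= Vq.
  have sS : Defs.tsize S = (Defs.tsize U + Defs.tsize V)%N by rewrite Up Vq subnKC.
  rewrite /upper -Up; apply/asboolP/andP => [|[/asboolP lo /asboolP hi]].
    by case/(taskin_triP sS) => lo hi; split; apply/asboolP.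
  exact/taskin_triP.
rewrite (exchange_big_dep xpredT) //= big_mkcond big_seq [RHS]big_seq.
apply: eq_bigr => V; rewrite mem_SYT => /eqP Vq.
(* For fixed [U] and [V], only W = [tri V U] contributes. *)
rewrite [RHS]big_mkcond (bigD1_seq (tri V U)) ?uniq_SYT //=; last first.
  by rewrite mem_SYT tsize_tri Up Vq subnKC.
by rewrite eqxx andbT big1 ?addr0 // => W WVU; rewrite eq_sym (negbTE WVU) andbF.
Qed.

Theorem theorem6p1 (n : nat) (Sigma : stdtab) (hSigma : Sigma \in SYT n) :
  delta (mono Sigma) =
  \sum_(p < n.+1) \sum_(U <- SYT p) \sum_(V <- SYT (n - p)%N | tri V U == Sigma)
     tens (mono U) (mono V).
Proof.
move: hSigma; rewrite mem_SYT => /eqP <-; rewrite -/(mono_delta Sigma).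
(* Induction on the size of the up-set, so that the formula is available for every tableau strictly
   above. *)
have [k] := ubnP (count (upper Sigma) (SYT (Defs.tsize Sigma))).
elim: k Sigma => // k IH S; rewrite ltnS => Sk.
have SS : upper S S by apply/asboolP/taskin_refl.
have mS : S \in SYT (Defs.tsize S) by rewrite mem_SYT.
(* Two expansions of the coproduct of [S] over its up-set are compared: the terms with W different
   from [S] agree by induction and cancel. *)
have := congr1 delta (sum_mono S); rewrite /delta fgliftU1 fglift_sum delta_tab_mono.
rewrite !big_upperD1.
rewrite (_ : \sum_(W <- _ | _) fglift delta_tab (mono W) =
             \sum_(W <- SYT (Defs.tsize S) | upper S W && (W != S)) mono_delta W); last first.
  apply: eq_bigr => W /andP[SW WS]; apply: IH.
  exact: leq_trans (upper_count_lt SW WS) Sk.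
by move/addIr.
Qed.
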